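(* Let $Y_0=R\,\gamma+S\,X\sim\mathrm{GMN}_d(0,\Sigma,\gamma,H)$ (that is, a GMN variable with $\xi=0$), and suppose $\mathbb{E}\{R^2\}$ and $\mathbb{E}\{S^2\}$ exist (are finite). Put $$\Omega=\Sigma+\gamma\gamma^\top,\qquad \alpha^2=\gamma^\top\Sigma^{-1}\gamma,\qquad \delta^2=\frac{\alpha^2}{1+\alpha^2}.$$ Then $$S^{-2}\,(Y_0-R\gamma)^\top\Sigma^{-1}(Y_0-R\gamma)\sim\chi^2_d,$$ $$\mathbb{E}\{Y_0^\top\Sigma^{-1}Y_0\}=d\,\mathbb{E}\{S^2\}+\alpha^2\,\mathbb{E}\{R^2\},$$ $$\mathbb{E}\{Y_0^\top\Omega^{-1}Y_0\}=d\,\mathbb{E}\{S^2\}+\delta^2\left(\mathbb{E}\{R^2\}-\mathbb{E}\{S^2\}\right).$$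
   Context: Generalized mixtures of normals (GMN). Let $\Sigma$ be a $d\times d$ symmetric positive definite matrix and $\xi,\gamma\in\mathbb{R}^d$. Let $X\sim\mathrm{N}_d(0,\Sigma)$ be a $d$-dimensional normal variable and $U,V$ univariate random variables such that $X,U,V$ are mutually independent. Let $r(u,v)$ be a real-valued function and $s(u,v)$ a positive-valued function, and let $R=r(U,V)$, $S=s(U,V)$ be the resulting random variables, so that $(R,S)$ is independent of $X$. Denote by $H$ the joint distribution (function) of $(R,S)$. If $Y=\xi+R\,\gamma+S\,X$, one writes $Y\sim\mathrm{GMN}_d(\xi,\Sigma,\gamma,H)$. $\chi^2_d$ denotes the chi-squared distribution with $d$ degrees of freedom. *)

(* Defs.v *)
From HB Require Import structures.
From mathcomp Require Import all_boot all_order all_algebra.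
From mathcomp Require Import all_classical all_reals all_analysis.

Set Implicit Arguments.
Unset Strict Implicit.
Unset Printing Implicit Defensive.

Import Order.TTheory GRing.Theory Num.Theory.
Import numFieldNormedType.Exports.

Local Open Scope classical_set_scope.
Local Open Scope ring_scope.

(* Column vectors carry the product sigma-algebra (the smallest one making the
   coordinates measurable), like n.-tuple T; for T = R this is Borel R^n. *)
Definition measure_cV_display : measure_display -> measure_display.
Proof. exact. Qed.

Section measurable_cV.
Context {d : measure_display} {T : sigmaRingType d} (n : nat).

Let coors : 'I_n -> 'cV[T]_n -> T := fun i x => x i 0.

Let cV_set0 : g_sigma_preimage coors set0.
Proof. exact: sigma_algebra0. Qed.

Let cV_setC A : g_sigma_preimage coors A -> g_sigma_preimage coors (~` A).
Proof. exact: sigma_algebraC. Qed.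

Let cV_bigcup (F : (set 'cV[T]_n)^nat) :
  (forall i, g_sigma_preimage coors (F i)) ->
  g_sigma_preimage coors (\bigcup_i (F i)).
Proof. exact: sigma_algebra_bigcup. Qed.

HB.instance Definition _ := @isMeasurable.Build (measure_cV_display d)
  'cV[T]_n (g_sigma_preimage coors) cV_set0 cV_setC cV_bigcup.

End measurable_cV.

Section measurable_cV_theory.
Context {d d' : measure_display} {T : measurableType d} {U : measurableType d'}.

Lemma measurable_cV_coord n (i : 'I_n) :
  measurable_fun [set: 'cV[T]_n] (fun x => x i 0).
Proof.
move=> _ Y mY; rewrite setTI; apply: sub_sigma_algebra => /=.
rewrite -bigcup_seq/=; exists i => /=; first by rewrite mem_index_enum.
by exists Y => //; rewrite setTI.
Qed.

Lemma measurable_fun_cVP n (f : U -> 'cV[T]_n) :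
  (forall i, measurable_fun [set: U] (fun u => f u i 0)) ->
  measurable_fun [set: U] f.
Proof.
move=> mf; apply: (measurability (\big[setU/set0]_(i < n)
  preimage_set_system setT (fun x : 'cV[T]_n => x i 0) measurable)) => //.
move=> _ [C + <-]; rewrite -bigcup_seq/= => -[i _ [B mB <-]].
by rewrite setTI; exact: mf.
Qed.

End measurable_cV_theory.

Definition cons_cV (T : Type) (n : nat) (xv : T * 'cV[T]_n) : 'cV[T]_n.+1 :=
  col_mx (const_mx xv.1 : 'cV_1) xv.2.

Lemma measurable_cons_cV d (T : measurableType d) n :
  measurable_fun [set: T * 'cV[T]_n] (@cons_cV T n).
Proof.
apply: measurable_fun_cVP => i; rewrite /cons_cV.
under eq_fun do rewrite mxE.
case: (@fintype.split 1 n i) => [j|j].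
- under eq_fun do rewrite mxE.
  exact: measurable_fst.
- exact: measurableT_comp (measurable_cV_coord j) measurable_snd.
Qed.

Section product_power.
Local Open Scope ereal_scope.
Context {R : realType}.
Variable mu : {sigma_finite_measure set (measurableTypeR R) -> \bar R}.

Section step.
Variables (n : nat) (nu : {measure set 'cV[R]_n -> \bar R}).

Definition cons_measure : set 'cV[R]_n.+1 -> \bar R :=
  pushforward (mu \x^ nu) (@cons_cV R n).

Let measurable_cons_cVR :
  measurable_fun [set: measurableTypeR R * 'cV[R]_n] (@cons_cV R n).
Proof. exact: (@measurable_cons_cV _ R n). Qed.

Let cons_measure0 : cons_measure set0 = 0.
Proof. by rewrite /cons_measure /pushforward preimage_set0 measure0. Qed.

Let cons_measure_ge0 A : 0 <= cons_measure A.
Proof. exact: measure_ge0. Qed.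

Let cons_measure_sigma_additive : semi_sigma_additive cons_measure.
Proof.
move=> F mF tF mUF; rewrite /cons_measure /pushforward preimage_bigcup.
apply: measure_semi_sigma_additive.
- by move=> k; rewrite -[X in measurable X]setTI; exact: measurable_cons_cVR.
- apply/trivIsetP => /= i j _ _ ij; rewrite -preimage_setI.
  by move/trivIsetP : tF => /(_ _ _ _ _ ij) ->//; rewrite preimage_set0.
- rewrite -preimage_bigcup -[X in measurable X]setTI.
  exact: measurable_cons_cVR.
Qed.

HB.instance Definition _ := isMeasure.Build _ _ _ cons_measure
  cons_measure0 cons_measure_ge0 cons_measure_sigma_additive.

End step.

(* The n-fold product measure mu \x ... \x mu on R^n. *)
Fixpoint power_measure (n : nat) : {measure set 'cV[R]_n -> \bar R} :=
  match n with
  | 0 => dirac (0%R : 'cV[R]_0)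
  | m.+1 => cons_measure (power_measure m)
  end.

End product_power.

Definition lebesgue_cV (R : realType) (n : nat) :
    {measure set 'cV[R]_n -> \bar R} :=
  power_measure (@lebesgue_measure R) n.

Definition qform (R : pzRingType) (n : nat) (A : 'M[R]_n) (x : 'cV[R]_n) : R :=
  (x^T *m A *m x) 0 0.

Definition sym_posdef (R : realType) (n : nat) (A : 'M[R]_n) : Prop :=
  A^T = A /\ forall x : 'cV[R]_n, x != 0 -> 0 < qform A x.

(* N_n(m, Sigma) for Sigma symmetric positive definite, given as usual by its
   density with respect to Lebesgue measure on R^n. *)
Definition mvnormal_pdf (R : realType) (n : nat) (m : 'cV[R]_n)
    (Sigma : 'M[R]_n) (x : 'cV[R]_n) : R :=
  (Num.sqrt ((pi *+ 2) ^+ n * \det Sigma))^-1 *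
  expR (- qform (invmx Sigma) (x - m) / 2).

Definition mvnormal_prob (R : realType) (n : nat) (m : 'cV[R]_n)
    (Sigma : 'M[R]_n) : set 'cV[R]_n -> \bar R :=
  fun A => (\int[lebesgue_cV R n]_(x in A) (mvnormal_pdf m Sigma x)%:E)%E.

(* chi^2_n is the law of Z_1^2 + ... + Z_n^2 for independent standard normal
   Z_1, ..., Z_n. *)
Definition chi_squared_prob (R : realType) (n : nat) : set R -> \bar R :=
  pushforward (power_measure (@normal_prob R 0 1) n)
    (fun z : 'cV[R]_n => \sum_(i < n) z i 0 ^+ 2).

Definition has_law d d' (T : measurableType d) (T' : measurableType d')
    (R : realType) (P : probability T R) (X : T -> T')
    (mu : set T' -> \bar R) : Prop :=
  measurable_fun [set: T] X /\
  forall A, measurable A -> P (X @^-1` A) = mu A.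

(* Mutual independence of three random variables; the product rules for the
   pairs are the cases where one of the sets is the whole space. *)
Definition mutually_independent3 d d1 d2 d3 (T : measurableType d)
    (T1 : measurableType d1) (T2 : measurableType d2) (T3 : measurableType d3)
    (R : realType) (P : probability T R)
    (X1 : T -> T1) (X2 : T -> T2) (X3 : T -> T3) : Prop :=
  forall A1 A2 A3, measurable A1 -> measurable A2 -> measurable A3 ->
  P (X1 @^-1` A1 `&` X2 @^-1` A2 `&` X3 @^-1` A3) =
  (P (X1 @^-1` A1) * P (X2 @^-1` A2) * P (X3 @^-1` A3))%E.

(* Y ~ GMN_n(xi, Sigma, gamma, H) through the representation
   Y = xi + R gamma + S X with R = r(U, V) and S = s(U, V). *)
Record GMN d (T : measurableType d) (R : realType) (P : probability T R)
    (n : nat) (xi : 'cV[R]_n) (Sigma : 'M[R]_n) (gamma : 'cV[R]_n)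
    (H : probability (R * R)%type R)
    (X : {RV P >-> 'cV[R]_n}) (U V : {RV P >-> R}) (r s : R -> R -> R)
    (Rv Sv : {RV P >-> R}) (Y : {RV P >-> 'cV[R]_n}) : Prop := {
  GMN_posdef : sym_posdef Sigma ;
  GMN_normal : has_law P X (mvnormal_prob 0 Sigma) ;
  GMN_indep : mutually_independent3 P X U V ;
  GMN_meas_r : measurable_fun [set: R * R] (fun uv => r uv.1 uv.2) ;
  GMN_meas_s : measurable_fun [set: R * R] (fun uv => s uv.1 uv.2) ;
  GMN_s_gt0 : forall u v, 0 < s u v ;
  GMN_R : forall w, Rv w = r (U w) (V w) ;
  GMN_S : forall w, Sv w = s (U w) (V w) ;
  GMN_H : has_law P (fun w => (Rv w, Sv w)) H ;
  GMN_Y : forall w, Y w = xi + Rv w *: gamma + Sv w *: X w }.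

(* Main.v *)
Require Import Defs.
From HB Require Import structures.
From mathcomp Require Import all_boot all_order all_algebra.
From mathcomp Require Import all_classical all_reals all_analysis.
From mathcomp Require Import measurable_realfun ring lra.

(** Since Sigma is positive definite, it has a Cholesky factorization
    Sigma = L L^T, and W = L^-1 X turns out to be a vector of independent
    standard normal variables ([cholesky_whitening]).  This is the bridge
    between the definition of the normal law by its density and the definition
    of the chi-squared law as the law of W_1^2 + ... + W_d^2, and it rests on
    the change of variables x = L z in Lebesgue integrals over R^d
    ([ge0_integral_lebesgue_cV_trig]).  Because L is triangular, that change of
    variables reduces to dimension one: when the coordinates are integrated one
    after the other (Tonelli, [integral_power_measureS]), each of them undergoes
    an affine map whose shift depends only on the coordinates already fixed.

    The first claim is then algebra: S^-1 (Y0 - R gamma) = X = L W, so the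
    quadratic form in Sigma^-1 equals W_1^2 + ... + W_d^2.

    For the two expectations, one formula covers both ([GMN_qform_mean]): for
    every matrix A,
      E (Y0^T A Y0) = (gamma^T A gamma) E R^2 + tr (A Sigma) E S^2.
    Indeed Y0 = R gamma + S L W, so Y0^T A Y0 is the sum of
    (gamma^T A gamma) R^2, of R S times a linear form in W, and of S^2 times
    the quadratic form of L^T A L in W.  As W is independent of (R, S), the
    means factor ([has_meanM]); a linear form in W has mean 0 and the quadratic
    form of B in W has mean tr B, because E W_i = 0 and E W_i W_j is 1 if
    i = j and 0 otherwise.
    With A = Sigma^-1 the trace is d.  With A = Omega^-1, the Sherman-Morrison
    formula ([qform_invmx_rank1]) gives gamma^T Omega^-1 gamma = delta^2, and
    Sigma = Omega - gamma gamma^T gives tr (Omega^-1 Sigma) = d - delta^2. *)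

Set Implicit Arguments.
Unset Strict Implicit.
Unset Printing Implicit Defensive.

Import Order.TTheory GRing.Theory Num.Theory.
Import numFieldNormedType.Exports.

Local Open Scope classical_set_scope.
Local Open Scope ring_scope.

(** * Powers of a measure on column vectors *)

Section coordinates.
Context (R : realType).

Lemma cons_cV0 (n : nat) (x : R) (v : 'cV[R]_n) : cons_cV (x, v) ord0 0 = x.
Proof.
rewrite /cons_cV (_ : ord0 = @lshift 1 n ord0); last exact: val_inj.
by rewrite [LHS]col_mxEu mxE.
Qed.

Lemma cons_cVS (n : nat) (x : R) (v : 'cV[R]_n) (i : 'I_n) :
  cons_cV (x, v) (lift ord0 i) 0 = v i 0.
Proof.
rewrite /cons_cV (_ : lift ord0 i = @rshift 1 n i); last exact: val_inj.
exact: col_mxEd.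
Qed.

End coordinates.

Section boxes.
Context (R : realType).

Definition box (n : nat) (A : 'I_n -> set R) : set 'cV[R]_n :=
  [set z | forall i, A i (z i 0)].

Lemma measurable_box (n : nat) (A : 'I_n -> set R) :
  (forall i, measurable (A i)) -> measurable (box A).
Proof.
move=> mA; rewrite (_ : box A =
    \bigcap_(i in [set: 'I_n]) ((fun z : 'cV[R]_n => z i 0) @^-1` A i));
  last first.
  by apply/seteqP; split=> [z Az i _|z Az i] /=; exact: Az.
apply: fin_bigcap_measurable => // i _; rewrite -[X in measurable X]setTI.
exact: measurable_cV_coord.
Qed.

Variable mu : {sigma_finite_measure set (measurableTypeR R) -> \bar R}.

(** The product rule on boxes; it yields sigma-finiteness of the powers, as
    well as the marginals and the independence of the coordinates. *)
Lemma power_measure_box (n : nat) (A : 'I_n -> set R) :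
  (forall i, measurable (A i)) ->
  power_measure mu n (box A) = (\prod_(i < n) mu (A i))%E.
Proof.
elim: n A => [|n IHn] A mA.
  by rewrite big_ord0 /= diracE mem_set// => -[].
rewrite big_ord_recl -IHn; last by move=> i; exact: mA.
rewrite -product_measure2E;
  [|exact: mA|by apply: measurable_box => i; exact: mA].
rewrite /= /cons_measure /pushforward; congr (_ _).
apply/seteqP; split=> [[x v] /= Axv|[x v] /= [Ax Av] i].
  split=> /=; first by rewrite -(cons_cV0 x v); exact: Axv.
  by move=> i; rewrite -(cons_cVS x v); exact: Axv.
case: (unliftP ord0 i) => [j ->|->]; rewrite ?cons_cV0 ?cons_cVS//; exact: Av.
Qed.

Lemma power_measure_sigma_finite (n : nat) :
  sigma_finite [set: 'cV[R]_n] (power_measure mu n).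
Proof.
have /sigma_finiteP [F [TF ndF Foo]] := sigma_finiteT mu.
exists (fun k => box (fun _ : 'I_n => F k)).
  apply/seteqP; split=> // z _.
  have /choice [k zk] : forall i : 'I_n, exists k, F k (z i 0).
    move=> i; have [k _ Fk] : (\bigcup_k F k) (z i 0) by rewrite -TF.
    by exists k.
  exists (\max_i k i)%N => // i /=.
  by move: (zk i); exact/subsetPset/ndF/leq_bigmax.
move=> k; have mFk := (Foo k).1; split; first exact: measurable_box.
rewrite power_measure_box// ltey_eq; apply/orP; left.
apply: prode_fin_num => i _; rewrite ge0_fin_numE//; exact: (Foo k).2.
Qed.

End boxes.

Section tonelli.
Local Open Scope ereal_scope.
Context (R : realType).
Variable mu : {sigma_finite_measure set (measurableTypeR R) -> \bar R}.
Variables (n : nat) (f : 'cV[R]_n.+1 -> \bar R).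
Hypotheses (f0 : forall z, 0 <= f z)
  (mf : measurable_fun [set: 'cV[R]_n.+1] f).

(* An alias with its own canonical sigma-finite structure, needed for
   the inner integral to be taken over the tail of the vector. *)
Let nu : set 'cV[R]_n -> \bar R := power_measure mu n.

HB.instance Definition _ := Measure.on nu.

HB.instance Definition _ :=
  @Measure_isSigmaFinite.Build _ _ _ nu (power_measure_sigma_finite mu n).

Let fcons (z : measurableTypeR R * 'cV[R]_n) : \bar R := f (cons_cV z).

Let mcons :
  measurable_fun [set: measurableTypeR R * 'cV[R]_n] (@cons_cV R n).
Proof. exact: (@measurable_cons_cV _ R n). Qed.

Let mfcons : measurable_fun [set: measurableTypeR R * 'cV[R]_n] fcons.
Proof. exact: measurableT_comp mf mcons. Qed.

Lemma measurable_power_section :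
  measurable_fun [set: measurableTypeR R]
    (fun x : R => \int[power_measure mu n]_v f (cons_cV (x, v))).
Proof.
by apply: (measurable_fun_fubini_tonelli_F (m2 := nu) fcons) => // z; exact: f0.
Qed.

(** Tonelli for the head and the tail of a vector, the head being integrated
    last.  [cons_measure] is defined by the product that integrates the
    measures of the sections over the tail; sigma-finiteness makes both
    products coincide. *)
Lemma integral_power_measureS :
  \int[power_measure mu n.+1]_z f z =
  \int[mu]_x \int[power_measure mu n]_v f (cons_cV (x, v)).
Proof.
rewrite ge0_integral_pushforward//= preimage_setT.
rewrite -[RHS](@fubini_tonelli1 _ _ _ _ _ mu nu fcons)//; last first.
  by move=> z; exact: f0.
apply: eq_measure_integral => A mA _; apply/esym.
by apply: product_measure_unique => // B C mB mC /=; rewrite product_measure2E.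
Qed.

End tonelli.

(** * One-dimensional Lebesgue and normal integrals *)

(** [pushforward] as a bundled measure: its measure structure takes the
    measurability of [f] as an argument, which inference cannot supply when
    [f] is a plain function. *)
Definition image_measure d1 d2 (T1 : measurableType d1) (T2 : measurableType d2)
    (R : realType) (m : {measure set T1 -> \bar R}) (f : T1 -> T2)
    (mf : measurable_fun [set: T1] f) : {measure set T2 -> \bar R} :=
  measure_function_pushforward__canonical__measure_function_Measure m mf.

Section lebesgue_affine.
Context (R : realType).
Notation mu := (@lebesgue_measure R).

(** Lebesgue measure and the image of a times Lebesgue measure under
    x |-> a x + b agree on the intervals ]x, y]. *)
Lemma ge0_integral_affine (a b : R) (f : R -> \bar R) :
  0 < a -> measurable_fun [set: R] f -> (forall x, 0 <= f x)%E ->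
  (\int[mu]_x f x = a%:E * \int[mu]_x f (a * x + b)%R)%E.
Proof.
move=> a0 mf f0.
pose h (x : R) : measurableTypeR R := (a * x + b)%R.
have mh : measurable_fun [set: R] h.
  by apply: measurable_funD => //; exact: measurable_funM.
have a0' : (0 <= a)%R by exact: ltW.
pose nu := mscale (NngNum a0') (image_measure mu mh).
have muE (A : set R) : measurable A -> mu A = nu A.
  apply: lebesgue_measure_unique => _ [[x y]] _ <-.
  rewrite [RHS](_ : _ = a%:E * mu (h @^-1` `]x, y]))%E//.
  have -> : h @^-1` `]x, y] = `](x - b) / a, (y - b) / a]%classic.
    apply/seteqP; split=> z;
      by rewrite /h /= !in_itv/= ltr_pdivrMr// ler_pdivlMr// ltrBlDr lerBrDr
        mulrC.
  rewrite !lebesgue_measure_itv/= !lte_fin ltr_pM2r ?invr_gt0// ltrD2r.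
  case: ifPn => _; last by rewrite mule0.
  by rewrite -!EFinB -EFinM; congr EFin; field; rewrite gt_eqF.
rewrite (eq_measure_integral nu) => [|A mA _]; last exact: muE.
by rewrite ge0_integral_mscale// ge0_integral_pushforward.
Qed.

Lemma ge0_integralN (f : R -> \bar R) :
  measurable_fun [set: R] f -> (forall x, 0 <= f x)%E ->
  (\int[mu]_x f x = \int[mu]_x f (- x)%R)%E.
Proof.
move=> mf f0; have mN : measurable_fun [set: measurableTypeR R]
    (-%R : measurableTypeR R -> measurableTypeR R).
  exact: oppr_measurable.
rewrite -[RHS](@ge0_integral_pushforward _ _ _ _ _ _ mN mu setT)//.
by apply: eq_measure_integral => A mA _; exact/esym/lebesgue_measureN.
Qed.

End lebesgue_affine.

Section standard_normal.
Context (R : realType).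
Notation mu := (@lebesgue_measure R).
Notation phi := (normal_pdf (0 : R) 1).

Lemma normal_pdf01E (x : R) :
  phi x = (normal_peak 1 * expR (- (x ^+ 2) / 2))%R.
Proof.
by rewrite normal_pdfE ?oner_eq0// /normal_fun subr0 expr1n.
Qed.

(** The density is a Radon-Nikodym derivative, by its almost everywhere
    uniqueness. *)
Lemma ge0_integral_normal_prob (m s : R) (f : R -> \bar R) :
  measurable_fun [set: R] f -> (forall x, 0 <= f x)%E ->
  (\int[normal_prob m s]_x f x = \int[mu]_x (f x * (normal_pdf m s x)%:E))%E.
Proof.
move=> mf f0; have dom := normal_prob_dominates m s.
rewrite -(Radon_Nikodym_SigmaFinite.change_of_variables dom)//.
have irn := Radon_Nikodym_SigmaFinite.f_integrable dom.
have mpdf : measurable_fun [set: R] (fun x => (normal_pdf m s x)%:E).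
  by apply/measurable_EFinP; exact: measurable_normal_pdf.
apply: ae_eq_integral => //.
- by apply: emeasurable_funM => //; exact: measurable_int irn.
- exact: emeasurable_funM.
- apply: ae_eqe_mul2l; apply: integral_ae_eq => // A _ mA.
  by rewrite -Radon_Nikodym_SigmaFinite.f_integral.
Qed.

Let is_derive_xphi (x : R) :
  is_derive x 1 (fun y : R => y * phi y) ((1 - x ^+ 2) * phi x).
Proof.
have -> : (fun y => y * phi y) =
    (fun y => y * (normal_peak 1 * expR (- (y ^+ 2) / 2))).
  by apply/funext => y; rewrite normal_pdf01E.
by apply: is_derive_eq; rewrite normal_pdf01E /GRing.scale /=; field.
Qed.

Let is_derive_Nxphi (x : R) :
  is_derive x 1 (fun y : R => - (y * phi y)) ((x ^+ 2 - 1) * phi x).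
Proof.
have := is_derive_xphi x => ?.
have -> : (fun y : R => - (y * phi y)) = - (fun y => y * phi y) by [].
by apply: is_derive_eq; rewrite -mulNr opprB.
Qed.

Let phi_ge0 (x : R) : 0 <= phi x. Proof. exact: normal_pdf_ge0. Qed.

Let continuous_phi : continuous phi.
Proof. by apply: continuous_normal_pdf; exact: oner_neq0. Qed.

Let cvg_xphi : - (x * phi x) @[x --> +oo] --> (0 : R).
Proof.
rewrite -[X in _ --> X]oppr0; apply: (@cvgN _ R^o).
apply: (@squeeze_cvgr _ _ _ _ (cst 0) (fun x => (normal_peak 1 * 2) * x^-1)).
- near=> x.
  have x0 : 0 < x by near: x; exact: nbhs_pinfty_gt.
  rewrite mulr_ge0 ?(ltW x0)//= normal_pdf01E mulNr expRN.
  (* x exp(- x^2 / 2) <= 2 / x, since exp(x^2 / 2) >= x^2 / 2 *)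
  rewrite mulrCA -mulrA ler_wpM2l ?normal_peak_ge0//.
  rewrite ler_pdivrMr ?expR_gt0// mulrAC ler_pdivlMr//.
  rewrite -ler_pdivrMl// mulrC -expr2.
  by apply: le_trans (expR_ge1Dx _); rewrite lerDr.
- exact: cvg_cst.
- rewrite -[X in _ --> X](mulr0 (normal_peak 1 * 2)); apply: cvgM.
    exact: cvg_cst.
  by apply/gtr0_cvgV0; [exact: nbhs_pinfty_gt|].
Unshelve. all: by end_near. Qed.

Let cvg_at_xphi (x : R) : y * phi y @[y --> x] --> x * phi x.
Proof. by apply: cvgM; [exact: cvg_id|exact: continuous_phi]. Qed.

Let integral01 :
  (\int[mu]_(x in `[0%R, 1%R]) ((1 - x ^+ 2) * phi x)%:E = (phi 1)%:E)%E.
Proof.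
rewrite (@continuous_FTC2 _ _ (fun x => x * phi x))//.
- by rewrite mul1r mul0r sube0.
- apply: continuous_subspaceT => x; apply: cvgM; last exact: continuous_phi.
  by apply: (@cvgB _ R^o); [exact: cvg_cst|exact: sqr_continuous].
- split=> [x _||].
  + exact: (@ex_derive _ _ _ _ _ _ _ (is_derive_xphi x)).
  + exact/cvg_at_right_filter/cvg_at_xphi.
  + exact/cvg_at_left_filter/cvg_at_xphi.
- by move=> x _; rewrite derive1E (derive_val (is_derive := is_derive_xphi x)).
Qed.

Let integral1y :
  (\int[mu]_(x in `[1%R, +oo[) ((x ^+ 2 - 1) * phi x)%:E = (phi 1)%:E)%E.
Proof.
rewrite (@ge0_continuous_FTC2y _ _ (fun x => - (x * phi x)) _ 0)//.
- by rewrite mul1r EFinN oppeK add0e.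
- by move=> x x1; rewrite mulr_ge0// subr_ge0 exprn_ege1.
- apply: continuous_subspaceT => x; apply: cvgM; last exact: continuous_phi.
  by apply: (@cvgB _ R^o); [exact: sqr_continuous|exact: cvg_cst].
- by move=> x _; exact: (@ex_derive _ _ _ _ _ _ _ (is_derive_Nxphi x)).
- by apply: (@cvgN _ R^o); exact/cvg_at_right_filter/cvg_at_xphi.
- by move=> x _; rewrite derive1E (derive_val (is_derive := is_derive_Nxphi x)).
Qed.

Let Dpos : [set x : R | 0 <= x] = `[0, 1] `|` `]1, +oo[.
Proof.
rewrite -set_itvcy (@itv_bndbnd_setU _ _ _ (BRight 1))//.
by rewrite bnd_simp.
Qed.

Let continuous_sqrphi : continuous (fun x : R => x ^+ 2 * phi x).
Proof.
by move=> x; apply: cvgM; [exact: sqr_continuous|exact: continuous_phi].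
Qed.

Let mphi : measurable_fun [set: R] phi.
Proof. exact: measurable_normal_pdf. Qed.

(** The derivative of x phi(x) is (1 - x^2) phi(x) and x phi(x) vanishes at 0
    and at infinity, so x^2 phi and phi have the same integral over the
    half-line.  The fundamental theorem of calculus on a half-line wants an
    integrand of constant sign, so the half-line is cut at 1, where 1 - x^2
    changes sign: phi(1) is lost on one piece and regained on the other. *)
Lemma integral_sqr_normal_pdf : (\int[mu]_x (x ^+ 2 * phi x)%:E = 1)%E.
Proof.
have m2 : measurable_fun [set: R] (fun x => x ^+ 2 * phi x).
  by apply: measurable_funM => //; exact: measurable_funX.
have mE (f : R -> R) (D : set R) : measurable D -> measurable_fun [set: R] f ->
    measurable_fun D (fun x => (f x)%:E).
  by move=> mD mf; apply/measurable_EFinP/measurable_funTS.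
have splitD (f : R -> R) : measurable_fun [set: R] f -> (forall x, 0 <= f x) ->
    (\int[mu]_(x in [set x : R | (0 <= x)%R]) (f x)%:E =
     \int[mu]_(x in `[0%R, 1%R]) (f x)%:E +
     \int[mu]_(x in `[1%R, +oo[) (f x)%:E)%E.
  move=> mf f0; rewrite Dpos ge0_integral_setU//.
  - by rewrite (@integral_itv_obnd_cbnd _ 1)//; exact: (mE f).
  - by apply: (mE f) => //; exact: measurableU.
  - by move=> x _; rewrite lee_fin.
  - apply/disj_setPS => x /= []; rewrite !in_itv/= andbT => /andP[_ x1].
    by rewrite ltNge x1.
rewrite -(integral_normal_pdf 0 1) !ge0_symfun_integralT//; last 3 first.
- by move=> x /=; rewrite !normal_pdf01E sqrrN.
- by move=> x; rewrite mulr_ge0// sqr_ge0.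
- by move=> x /=; rewrite !normal_pdf01E sqrrN.
congr (_ * _)%E; rewrite !splitD//; last first.
  by move=> x; rewrite mulr_ge0// sqr_ge0.
have -> : (\int[mu]_(x in `[0%R, 1%R]) (phi x)%:E =
   \int[mu]_(x in `[0%R, 1%R]) (x ^+ 2 * phi x)%:E + (phi 1)%:E)%E.
  rewrite -integral01 -ge0_integralD//.
  - by apply: eq_integral => x _; rewrite -EFinD; congr EFin; ring.
  - by move=> x _; rewrite lee_fin mulr_ge0// sqr_ge0.
  - by apply: mE.
  - move=> x /=; rewrite in_itv/= => /andP[x0 x1].
    by rewrite lee_fin mulr_ge0// subr_ge0 exprn_ile1.
  - by apply: mE => //; apply: measurable_funM => //; apply: measurable_funB.
have -> : (\int[mu]_(x in `[1%R, +oo[) (x ^+ 2 * phi x)%:E =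
   (phi 1)%:E + \int[mu]_(x in `[1%R, +oo[) (phi x)%:E)%E.
  rewrite -integral1y -ge0_integralD//.
  - by apply: eq_integral => x _; rewrite -EFinD; congr EFin; ring.
  - move=> x /=; rewrite in_itv/= andbT => x1.
    by rewrite lee_fin mulr_ge0// subr_ge0 exprn_ege1.
  - by apply: mE => //; apply: measurable_funM => //; apply: measurable_funB.
  - by move=> x _; rewrite lee_fin.
  - by apply: mE.
by rewrite addeA.
Qed.

Notation N01 := (normal_prob (0 : R) 1).

Lemma std_normal_second_moment : (\int[N01]_x (x ^+ 2)%:E = 1)%E.
Proof.
rewrite ge0_integral_normal_prob.
- by under eq_integral do rewrite -EFinM; exact: integral_sqr_normal_pdf.
- by apply/measurable_EFinP; exact: measurable_funX.
- by move=> x; rewrite lee_fin sqr_ge0.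
Qed.

(** |x| <= 1 + x^2 reduces this to the second moment. *)
Lemma integrable_std_normal : N01.-integrable [set: R] (fun x : R => x%:E).
Proof.
apply/integrableP; split; first exact/measurable_EFinP.
apply: (@le_lt_trans _ _ (\int[N01]_x (1 + (x ^+ 2)%:E))%E).
  apply: ge0_le_integral => //=.
  - by apply: measurableT_comp => //; exact/measurable_EFinP.
  - by apply: emeasurable_funD => //; apply/measurable_EFinP/measurable_funX.
  - move=> x _; rewrite lee_fin -real_normK ?num_real//.
    by have := sqr_ge0 (`|x| - 1); have := normr_ge0 x; nra.
rewrite ge0_integralD//=.
- rewrite std_normal_second_moment integral_cst//.
  rewrite mul1e lte_add_pinfty ?ltry//.
  exact: le_lt_trans (probability_le1 N01 measurableT) (ltry _).
- by move=> x _; rewrite lee_fin sqr_ge0.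
- by apply/measurable_EFinP; exact: measurable_funX.
Qed.

(** The density is even, so the positive and the negative part of the identity
    have the same integral. *)
Lemma std_normal_mean : (\int[N01]_x x%:E = 0)%E.
Proof.
have intid := integrable_std_normal.
have mid : measurable_fun [set: R] (fun x : R => x%:E).
  exact: measurable_int intid.
rewrite integralE; pose f (x : R) := x%:E.
suff -> : (\int[N01]_x f^\- x = \int[N01]_x f^\+ x)%E.
  rewrite subee// integrable_pos_fin_num//.
rewrite !ge0_integral_normal_prob//; last 2 first.
- exact: measurable_funepos.
- exact: measurable_funeneg.
rewrite [RHS]ge0_integralN.
- apply: eq_integral => x _; rewrite !normal_pdf01E sqrrN.
  by rewrite funeposE funenegE /f EFinN.
- apply: emeasurable_funM; first exact: measurable_funepos.
  exact/measurable_EFinP.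
- by move=> x; rewrite mule_ge0// lee_fin.
Qed.

End standard_normal.

(** * Quadratic forms and positive definite matrices *)

Section quadratic_forms.
Context (R : realType).

Lemma qformE (n : nat) (A : 'M[R]_n) (x : 'cV[R]_n) :
  qform A x = \sum_(i < n) \sum_(j < n) A i j * (x i 0 * x j 0).
Proof.
rewrite /qform -mulmxA mxE; apply: eq_bigr => i _; rewrite !mxE big_distrr/=.
by apply: eq_bigr => j _; rewrite mulrCA.
Qed.

Lemma qform_block (m n : nat) (A : 'M[R]_m) (B : 'M[R]_(m, n))
    (C : 'M[R]_(n, m)) (D : 'M[R]_n) (u : 'cV[R]_m) (v : 'cV[R]_n) :
  qform (block_mx A B C D) (col_mx u v) =
  (u^T *m A *m u + u^T *m B *m v + (v^T *m C *m u + v^T *m D *m v)) 0 0.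
Proof.
rewrite /qform tr_col_mx -mulmxA mul_block_col mul_row_col.
by rewrite !mulmxDr !mulmxA.
Qed.

Lemma qform_invmx_mulmx (n : nat) (L : 'M[R]_n) (z : 'cV[R]_n) :
  L \in unitmx ->
  qform (invmx (L *m L^T)) (L *m z) = \sum_(i < n) z i 0 ^+ 2.
Proof.
move=> Lu; have LTu : L^T \in unitmx by rewrite unitmx_tr.
have LLTu : L *m L^T \in unitmx by rewrite unitmx_mul Lu.
have LzE : L *m z = (L *m L^T) *m (invmx L^T *m z).
  by rewrite -mulmxA mulKVmx.
rewrite /qform -mulmxA [in X in _ *m X]LzE mulKmx// trmx_mul -mulmxA mulKVmx//.
by rewrite mxE; apply: eq_bigr => i _; rewrite mxE expr2.
Qed.

End quadratic_forms.

Lemma qformZ (R : comPzRingType) (n : nat) (A : 'M[R]_n) (c : R)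
    (x : 'cV[R]_n) :
  qform A (c *: x) = c ^+ 2 * qform A x.
Proof.
have trE : (c *: x)^T = c *: x^T by rewrite linearZ.
by rewrite /qform trE -scalemxAr -!scalemxAl !mxE mulrA.
Qed.

(** The cross terms gamma^T A L z and (L z)^T A gamma merge into one linear form
    in z once A is symmetrized. *)
Lemma qform_decomposition (R : comPzRingType) (n : nat) (A L : 'M[R]_n)
    (g z : 'cV[R]_n) (r s : R) :
  qform A (r *: g + s *: (L *m z)) =
  qform A g * r ^+ 2 + (g^T *m (A + A^T) *m L *m z) 0 0 * (r * s) +
  qform (L^T *m A *m L) z * s ^+ 2.
Proof.
have xAy (x y : 'cV[R]_n) : (x^T *m A *m y) 0 0 = (y^T *m A^T *m x) 0 0.
  rewrite -[in RHS](trmxK (y^T *m _ *m _)).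
  by rewrite [in RHS]mxE !trmx_mul !trmxK mulmxA.
have trE : (r *: g + s *: (L *m z))^T = r *: g^T + s *: (L *m z)^T.
  by rewrite linearD/= !linearZ.
rewrite /qform trE !(mulmxDl, mulmxDr) -!scalemxAr -!scalemxAl.
have -> : z^T *m (L^T *m A *m L) *m z = (L *m z)^T *m A *m (L *m z).
  by rewrite trmx_mul !mulmxA.
rewrite -![_ *m L *m z]mulmxA.
move: (xAy (L *m z) g); set y := L *m z => yAg.
rewrite !mxE in yAg *; rewrite -yAg.
ring.
Qed.

(** One step of elimination: with s the top left entry and v the rest of the
    first column, the first column of L is (a, v / a) where a^2 = s, and L goes
    on with a factor of the Schur complement D - v v^T / s. *)
Lemma cholesky (R : realType) (n : nat) (A : 'M[R]_n) : sym_posdef A ->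
  exists L : 'M[R]_n,
    [/\ is_trig_mx L, forall i, 0 < L i i & L *m L^T = A].
Proof.
elim: n A => [|n IHn] A [Asym Apos].
  exists 0; split; [|by case|by rewrite !thinmx0].
  by apply/is_trig_mxP => -[].
pose A' := A : 'M[R]_(1 + n).
pose s := ulsubmx A' 0 0; pose v := dlsubmx A'; pose D := drsubmx A'.
have ulE : ulsubmx A' = s%:M by rewrite [LHS]mx11_scalar.
have urE : ursubmx A' = v^T by rewrite /v trmx_dlsub Asym.
have Dsym : D^T = D by rewrite /D trmx_drsub Asym.
have AE : A' = block_mx s%:M v^T v D by rewrite -ulE -urE submxK.
have A'pos (x : 'cV_(1 + n)) : x != 0 -> 0 < qform A' x by exact: Apos.
have s0 : 0 < s.
  have := A'pos (col_mx 1%:M 0).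
  rewrite AE qform_block !trmx0 !mul0mx !mulmx0 !addr0 trmx1 mul1mx mulmx1.
  rewrite mxE eqxx mulr1n; apply; apply/eqP => /colP /(_ (lshift n 0)).
  by rewrite col_mxEu !mxE eqxx => /eqP; rewrite oner_eq0.
pose a := Num.sqrt s.
have a0 : 0 < a by rewrite sqrtr_gt0.
have aa : a * a = s by rewrite -expr2 sqr_sqrtr// ltW.
pose c := a^-1 *: v.
have [|L [trigL L0 LLT]] := IHn (D - c *m c^T).
  split; first by rewrite linearB/= trmx_mul trmxK Dsym.
  move=> y y0; pose w := v^T *m y.
  have wT : w^T = w by apply/matrixP => i j; rewrite mxE !ord1.
  have yv : y^T *m v = w by rewrite -wT /w trmx_mul trmxK.
  (* The head - w / s minimizes the form of A over the vectors with tail y,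
     and the minimum is the form of the Schur complement at y. *)
  have := A'pos (col_mx ((- s^-1) *: w) y).
  rewrite AE qform_block => /(_ _).
  have -> : ((- s^-1 *: w)^T *m s%:M *m (- s^-1 *: w) +
      (- s^-1 *: w)^T *m v^T *m y +
      (y^T *m v *m (- s^-1 *: w) + y^T *m D *m y)) 0 0 =
      qform (D - c *m c^T) y.
    rewrite /qform mulmxBr mulmxBl; congr (fun_of_matrix _ _ _).
    have -> : y^T *m (c *m c^T) *m y = s^-1 *: (w *m w).
      rewrite /c linearZ/= -!(scalemxAl, scalemxAr).
      rewrite !scalerA -invfM aa.
      by rewrite !mulmxA yv -mulmxA.
    rewrite -[_ *m v^T *m y]mulmxA -/w yv [(_ *: w)^T]linearZ/= wT; clearbody w.
    rewrite mul_mx_scalar -!scalemxAr -!scalemxAl !scalerA.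
    rewrite !mulNr mulVf ?gt_eqF// mul1r opprK.
    by rewrite !scaleNr subrr add0r addrC.
  apply; apply/eqP => /colP y0'; move/eqP: y0; apply.
  by apply/colP => i; have := y0' (rshift 1 i); rewrite col_mxEd !mxE.
pose M := block_mx a%:M 0 c L.
have trigM : is_trig_mx M by rewrite is_trig_block_mx// eqxx scalar_mx_is_trig.
have Mpos (i : 'I_(1 + n)%N) : 0 < M i i.
  case: (split_ordP i) => j ->.
  - by rewrite block_mxEul mxE (ord1 j) eqxx mulr1n.
  - by rewrite block_mxEdr.
suff MMT : M *m M^T = A' by exists M.
rewrite AE tr_block_mx mulmx_block.
rewrite !trmx0 !mulmx0 !mul0mx !addr0 LLT tr_scalar_mx -scalar_mxM aa.
rewrite mul_scalar_mx mul_mx_scalar addrC subrK.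
by rewrite !linearZ/= !scalerA mulVf ?gt_eqF// !scale1r.
Qed.

Lemma sym_posdef_unitmx (R : realType) (n : nat) (A : 'M[R]_n) :
  sym_posdef A -> A \in unitmx.
Proof.
move=> /cholesky [L [trigL L0 <-]]; rewrite unitmx_mul unitmx_tr andbb.
by rewrite unitmxE unitfE gt_eqF// det_trig// prodr_gt0.
Qed.

Lemma sym_posdef_rank1 (R : realType) (n : nat) (A : 'M[R]_n) (u : 'cV[R]_n) :
  sym_posdef A -> sym_posdef (A + u *m u^T).
Proof.
move=> [Asym Apos]; split; first by rewrite linearD/= trmx_mul trmxK Asym.
move=> x x0; rewrite /qform mulmxDr mulmxDl mxE ltr_wpDr ?Apos//.
rewrite mulmxA -mulmxA -[u^T *m x]trmxK trmx_mul trmxK mxE big_ord1.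
rewrite [X in _ * X]mxE.
by rewrite -expr2 sqr_ge0.
Qed.

Lemma sym_posdef_qform_invmx_ge0 (R : realType) (n : nat) (A : 'M[R]_n)
    (u : 'cV[R]_n) :
  sym_posdef A -> 0 <= qform (invmx A) u.
Proof.
move=> Apd; have Au := sym_posdef_unitmx Apd; case: Apd => Asym Apos.
have -> : qform (invmx A) u = qform A (invmx A *m u).
  by rewrite /qform trmx_mul trmx_inv Asym -!mulmxA mulKVmx.
have [->|x0] := eqVneq (invmx A *m u) 0; last exact/ltW/Apos.
by rewrite /qform mulmx0 mxE.
Qed.

(** Sherman-Morrison on the vector u itself: A + u u^T maps A^-1 u to
    (1 + u^T A^-1 u) u. *)
Lemma qform_invmx_rank1 (R : realType) (n : nat) (A : 'M[R]_n)
    (u : 'cV[R]_n) : sym_posdef A ->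
  qform (invmx (A + u *m u^T)) u =
  qform (invmx A) u / (1 + qform (invmx A) u).
Proof.
move=> Apd; have Au := sym_posdef_unitmx Apd.
have Ou := sym_posdef_unitmx (sym_posdef_rank1 u Apd).
set a := qform (invmx A) u.
have a0 : 1 + a != 0.
  by rewrite gt_eqF// ltr_wpDr ?sym_posdef_qform_invmx_ge0.
have OE : (A + u *m u^T) *m (invmx A *m u) = (1 + a) *: u.
  rewrite mulmxDl mulKVmx// scalerDl scale1r; congr (_ + _).
  rewrite -!mulmxA (mulmxA u^T) [u^T *m _ *m u]mx11_scalar mul_mx_scalar.
  by [].
have invOE : invmx (A + u *m u^T) *m u = (1 + a)^-1 *: (invmx A *m u).
  apply: (can_inj (mulKmx Ou)).
  by rewrite mulKVmx// -scalemxAr OE scalerA mulVf// scale1r.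
by rewrite /qform -mulmxA invOE -scalemxAr mxE mulrC mulmxA.
Qed.

(** * Triangular changes of variables and the normal law *)

Section triangular_change_of_variables.
Context (R : realType).

Lemma measurable_affine_cV (m n : nat) (L : 'M[R]_(m, n)) (b : 'cV[R]_m) :
  measurable_fun [set: 'cV[R]_n] (fun z => L *m z + b).
Proof.
apply: measurable_fun_cVP => i; under eq_fun do rewrite !mxE.
apply: measurable_funD => //; apply: measurable_sum => j.
by apply: measurable_funM => //; exact: measurable_cV_coord.
Qed.

Lemma measurable_mulmx_cV (m n : nat) (L : 'M[R]_(m, n)) :
  measurable_fun [set: 'cV[R]_n] (fun z => L *m z).
Proof.
by under eq_fun do rewrite -[_ *m _]addr0; exact: measurable_affine_cV.
Qed.

Lemma measurable_qform (n : nat) (A : 'M[R]_n) :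
  measurable_fun [set: 'cV[R]_n] (qform A).
Proof.
rewrite (_ : qform A =
    fun x => \sum_(i < n) \sum_(j < n) A i j * (x i 0 * x j 0));
  last by apply/funext => x; exact: qformE.
apply: measurable_sum => i; apply: measurable_sum => j.
by do 2 apply: measurable_funM => //; exact: measurable_cV_coord.
Qed.

Lemma measurable_cons_cV_section (n : nat) (x : R) :
  measurable_fun [set: 'cV[R]_n] (fun v => cons_cV (x, v)).
Proof.
apply: measurableT_comp; first exact: measurable_cons_cV.
by apply: measurable_fun_pair.
Qed.

(** By induction on the blocks (a 0; c L) of the triangular matrix: for a fixed
    head x of z, the tail is mapped by v |-> L v + (c x + b'), to which the
    induction hypothesis applies thanks to its free shift; the head is mapped
    by the affine function a x + b_0. *)
Lemma ge0_integral_lebesgue_cV_trig (n : nat) (L : 'M[R]_n) :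
  is_trig_mx L -> (forall i, 0 < L i i) ->
  forall (b : 'cV[R]_n) (f : 'cV[R]_n -> \bar R),
  measurable_fun [set: 'cV[R]_n] f -> (forall z, 0 <= f z)%E ->
  (\int[lebesgue_cV R n]_z f z =
   (\det L)%:E * \int[lebesgue_cV R n]_z f (L *m z + b)%R)%E.
Proof.
elim/trigsqmx_ind => {n L} [|n a c L trigL IHL] L0 b f mf f0.
  rewrite det_mx00 mul1e; apply: eq_integral => z _; congr f.
  by apply/matrixP => -[].
have {}IHL := IHL _.
have a0 : 0 < a 0 0.
  by have := L0 (lshift n ord0); rewrite block_mxEul.
have {}L0 (i : 'I_n) : 0 < L i i.
  by have := L0 (rshift 1 i); rewrite block_mxEdr.
have mfa : measurable_fun [set: 'cV[R]_(1 + n)]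
    (fun z => f (block_mx a 0 c L *m z + b)).
  exact: measurableT_comp mf (measurable_affine_cV _ _).
rewrite /lebesgue_cV !integral_power_measureS//.
rewrite (@ge0_integral_affine _ _ (b ord0 0) _ a0); last 2 first.
- exact: measurable_power_section.
- by move=> x; exact: integral_ge0.
rewrite det_lblock det_mx11 EFinM -muleA; congr (_ * _)%E.
rewrite -ge0_integralZl//; last 3 first.
- apply: measurable_power_section mfa => z; exact: f0.
- by move=> x _; exact: integral_ge0.
- by rewrite lee_fin det_trig// prodr_ge0// => i _; exact: ltW.
apply: eq_integral => x _.
rewrite -/(lebesgue_cV R n).
rewrite (IHL L0 (dsubmx (b : 'cV_(1 + n)) + c *m const_mx x)).
- congr (_ * _)%E; apply: eq_integral => v _; congr f.
  rewrite /cons_cV mul_block_col mul0mx addr0 -[X in _ = _ + X]vsubmxK.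
  rewrite add_col_mx; congr col_mx.
    apply/colP => i; rewrite !mxE (ord1 i) big_ord1 !mxE.
    by congr (_ + b _ _); exact: val_inj.
  by rewrite -[RHS]addrA addrCA [dsubmx _ + _]addrC.
- exact: measurableT_comp mf (measurable_cons_cV_section _).
- by move=> z.
Qed.

End triangular_change_of_variables.

Section gaussian_law.
Context (R : realType).
Notation N01 := (normal_prob (0 : R) 1).

Lemma ge0_integral_power_normal (n : nat) (f : 'cV[R]_n -> \bar R) :
  measurable_fun [set: 'cV[R]_n] f -> (forall z, 0 <= f z)%E ->
  (\int[power_measure N01 n]_z f z =
   \int[lebesgue_cV R n]_z
     (f z * (\prod_(i < n) normal_pdf 0 1 (z i 0))%:E))%E.
Proof.
elim: n f => [|n IHn] f mf f0.
  by apply: eq_integral => z _; rewrite big_ord0 mule1.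
have mpdf m : measurable_fun [set: 'cV[R]_m]
    (fun z => (\prod_(i < m) normal_pdf 0 1 (z i 0))%:E).
  apply/measurable_EFinP; apply: measurable_prod => i _.
  apply: measurableT_comp; first exact: measurable_normal_pdf.
  exact: measurable_cV_coord.
have pdf0 m (z : 'cV[R]_m) : (0 <= (\prod_(i < m) normal_pdf 0 1 (z i 0))%:E)%E.
  by rewrite lee_fin prodr_ge0// => i _; exact: normal_pdf_ge0.
rewrite /lebesgue_cV !integral_power_measureS//; last 2 first.
- by move=> z; exact: mule_ge0.
- exact: emeasurable_funM mf (mpdf n.+1).
rewrite ge0_integral_normal_prob; last 2 first.
- exact: measurable_power_section.
- by move=> x; exact: integral_ge0.
apply: eq_integral => x _; rewrite -/(lebesgue_cV R n).
have mfx : measurable_fun [set: 'cV[R]_n] (fun v => f (cons_cV (x, v))).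
  exact: measurableT_comp mf (measurable_cons_cV_section x).
rewrite IHn// -ge0_integralZr//; last 3 first.
- exact: emeasurable_funM mfx (mpdf n).
- by move=> v _; exact: mule_ge0.
- by rewrite lee_fin normal_pdf_ge0.
apply: eq_integral => v _; rewrite big_ord_recl cons_cV0 -muleA -EFinM mulrC.
by under [in RHS]eq_bigr do rewrite cons_cVS.
Qed.

(** Both sides are (2 pi)^(- n / 2) exp (- |z|^2 / 2): \det L is the square root
    of \det (L L^T). *)
Lemma mvnormal_pdf_mulmx (n : nat) (L : 'M[R]_n) (z : 'cV[R]_n) :
  0 < \det L ->
  \det L * mvnormal_pdf 0 (L *m L^T) (L *m z) =
  \prod_(i < n) normal_pdf 0 1 (z i 0).
Proof.
move=> detL0; have Lu : L \in unitmx by rewrite unitmxE unitfE gt_eqF.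
under [RHS]eq_bigr do rewrite normal_pdf01E.
rewrite big_split/= prodr_const card_ord -expR_sum -big_distrl/= sumrN.
rewrite /mvnormal_pdf subr0 qform_invmx_mulmx// mulrA; congr (_ * _).
rewrite det_mulmx det_tr -expr2 /normal_peak expr1n mul1r.
have pi2_ge0 : 0 <= pi *+ 2 :> R by rewrite mulrn_wge0// pi_ge0.
rewrite sqrtrM ?exprn_ge0// sqrtr_sqr gtr0_norm//.
rewrite invfM mulrCA divff ?gt_eqF// mulr1 exprVn; congr _^-1.
elim: n {L z detL0 Lu} => [|n IHn]; first by rewrite !expr0 sqrtr1.
by rewrite !exprS sqrtrM// IHn.
Qed.

(** The change of variables x = L z turns the density of N(0, L L^T) into the
    density of a standard normal vector, by [mvnormal_pdf_mulmx]. *)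
Lemma mvnormal_probE (n : nat) (L : 'M[R]_n) (A : set 'cV[R]_n) :
  is_trig_mx L -> (forall i, 0 < L i i) -> measurable A ->
  mvnormal_prob 0 (L *m L^T) A = power_measure N01 n [set z | A (L *m z)].
Proof.
move=> trigL L0 mA.
have detL0 : 0 < \det L by rewrite det_trig// prodr_gt0.
have Lu : L \in unitmx by rewrite unitmxE unitfE gt_eqF.
have mLA : measurable [set z | A (L *m z)].
  by rewrite -[X in measurable X]setTI; exact: measurable_mulmx_cV.
have mpdf : measurable_fun [set: 'cV[R]_n]
    (fun x => (mvnormal_pdf 0 (L *m L^T) x)%:E).
  apply/measurable_EFinP/measurable_funM => //; apply: measurableT_comp => //.
  apply: measurable_funM => //; apply: measurableT_comp => //.
  by under eq_fun do rewrite subr0; exact: measurable_qform.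
have pdf0 x : (0 <= (mvnormal_pdf 0 (L *m L^T) x)%:E)%E.
  by rewrite lee_fin mulr_ge0 ?expR_ge0// invr_ge0 sqrtr_ge0.
rewrite /mvnormal_prob integral_mkcond.
rewrite (ge0_integral_lebesgue_cV_trig trigL L0 0); last 2 first.
- by apply/(measurable_restrictT _ _).1 => //; exact: measurable_funTS.
- by move=> z; exact: erestrict_ge0.
rewrite -[in RHS](setIT [set z | A (L *m z)]) -integral_indic//.
rewrite ge0_integral_power_normal; last 2 first.
- exact/measurable_EFinP/measurable_indic.
- by move=> z; rewrite lee_fin.
rewrite -ge0_integralZl//; last 3 first.
- apply: measurableT_comp (measurable_affine_cV _ _) => /=.
  by apply/(measurable_restrictT _ _).1 => //; exact: measurable_funTS.
- by move=> z _; exact: erestrict_ge0.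
- by rewrite lee_fin ltW.
apply: eq_integral => z _; rewrite addr0 patchE indicE.
have -> : (z \in [set z | A (L *m z)]) = (L *m z \in A).
  by apply/idP/idP; rewrite !inE.
case: ifPn => _; last by rewrite mule0 mul0e.
by rewrite mul1e -EFinM mvnormal_pdf_mulmx.
Qed.

End gaussian_law.

(** * Independence and means *)

Section independence.
Context d d1 d2 (T : measurableType d) (T1 : measurableType d1)
  (T2 : measurableType d2) (R : realType).

(** Rectangles form a pi-system that generates the product sigma-algebra. *)
Lemma measure_rectangles_unique
    (m1 m2 : {measure set (T1 * T2) -> \bar R}) :
  (m1 setT < +oo)%E ->
  (forall A B, measurable A -> measurable B -> m1 (A `*` B) = m2 (A `*` B)) ->
  forall C, measurable C -> m1 C = m2 C.
Proof.
move=> m1oo m12 C mC.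
pose G : set (set (T1 * T2)) :=
  [set A `*` B | A in measurable & B in measurable].
apply: (measure_unique G (fun=> setT)) => //.
- exact: measurable_prod_measurableType.
- move=> _ _ [A mA [B mB <-]] [A' mA' [B' mB' <-]]; rewrite -setXI.
  by exists (A `&` A'); [exact: measurableI|exists (B `&` B') => //;
    exact: measurableI].
- by move=> _; exists setT => //; exists setT => //; rewrite setXTT.
- by rewrite bigcup_const//; exists 0%N.
- by move=> _ [A mA [B mB <-]]; exact: m12.
Qed.

Variables (P : probability T R) (f : T -> T1) (g : T -> T2).

Definition independent : Prop := forall A B, measurable A -> measurable B ->
  (P (f @^-1` A `&` g @^-1` B) = P (f @^-1` A) * P (g @^-1` B))%E.

End independence.

Lemma independent_comp d d1 d2 d3 d4 (T : measurableType d)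
    (T1 : measurableType d1) (T2 : measurableType d2)
    (T3 : measurableType d3) (T4 : measurableType d4)
    (R : realType) (P : probability T R) (f : T -> T1) (g : T -> T2)
    (p : T1 -> T3) (q : T2 -> T4) :
  measurable_fun [set: T1] p -> measurable_fun [set: T2] q ->
  independent P f g -> independent P (p \o f) (q \o g).
Proof.
move=> mp mq fg A B mA mB; apply: (fg (p @^-1` A) (q @^-1` B)).
- by rewrite -[X in measurable X]setTI; exact: mp.
- by rewrite -[X in measurable X]setTI; exact: mq.
Qed.

(** For a fixed event about X, the law of (U, V) on that event and the law of
    (U, V) scaled by the probability of the event agree on rectangles. *)
Lemma mutually_independent3_pair d d1 d2 d3 (T : measurableType d)
    (T1 : measurableType d1) (T2 : measurableType d2)
    (T3 : measurableType d3) (R : realType) (P : probability T R)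
    (X : T -> T1) (U : T -> T2) (V : T -> T3) :
  measurable_fun [set: T] X -> measurable_fun [set: T] U ->
  measurable_fun [set: T] V -> mutually_independent3 P X U V ->
  independent P X (fun w => (U w, V w)).
Proof.
move=> mX mU mV XUV A C mA mC.
have mXA : measurable (X @^-1` A).
  by rewrite -[X in measurable X]setTI; exact: mX.
have mUV : measurable_fun [set: T] (fun w => (U w, V w)).
  exact: measurable_fun_pair.
have PA_fin : P (X @^-1` A) \is a fin_num by exact: fin_num_measure.
pose m1 := image_measure (mrestr P mXA) mUV.
have c0 : 0 <= fine (P (X @^-1` A)) by exact: fine_ge0.
pose m2 : {measure set (T2 * T3) -> \bar R} :=
  mscale (NngNum c0) (image_measure P mUV).
have m1E B : m1 B = P (X @^-1` A `&` (fun w => (U w, V w)) @^-1` B).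
  by rewrite [in RHS]setIC.
have m2E B : m2 B = (P (X @^-1` A) * P ((fun w => (U w, V w)) @^-1` B))%E.
  by rewrite [LHS](_ : _ = (fine (P (X @^-1` A)))%:E *
    P ((fun w => (U w, V w)) @^-1` B))%E// fineK.
rewrite -m1E -m2E; apply: (@measure_rectangles_unique _ _ _ _ _ m1 m2) mC.
  rewrite m1E (le_lt_trans (probability_le1 _ _)) ?ltry//.
  by rewrite preimage_setT setIT.
move=> B D mB mD; rewrite m1E m2E.
have -> : (fun w => (U w, V w)) @^-1` (B `*` D) = U @^-1` B `&` V @^-1` D by [].
have := XUV A B D mA mB mD; have := XUV setT B D measurableT mB mD.
rewrite preimage_setT setTI probability_setT mul1e setIA => -> ->.
by rewrite muleA.
Qed.

Section has_mean.
Context d (T : measurableType d) (R : realType) (P : probability T R).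

(** Integrability together with the value of the expectation: the two facts
    propagate jointly through sums and independent products. *)
Definition has_mean (f : T -> R) (m : R) : Prop :=
  P.-integrable [set: T] (EFin \o f) /\ ('E_P[f] = m%:E)%E.

Lemma has_meanD (f g : T -> R) (a b : R) :
  has_mean f a -> has_mean g b -> has_mean (fun w => f w + g w) (a + b).
Proof.
rewrite /has_mean expectation.unlock => -[fi fa] [gi gb].
split; first exact: (integrableD measurableT fi gi).
by rewrite EFinD -fa -gb -(integralD measurableT fi gi).
Qed.

Lemma has_meanZ (k : R) (f : T -> R) (a : R) :
  has_mean f a -> has_mean (fun w => k * f w) (k * a).
Proof.
rewrite /has_mean expectation.unlock => -[fi fa].
split; first exact: (integrableZl measurableT k fi).
by rewrite EFinM -fa -(integralZl measurableT fi).
Qed.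

Lemma has_mean_sum (I : Type) (s : seq I) (f : I -> T -> R) (a : I -> R) :
  (forall i, has_mean (f i) (a i)) ->
  has_mean (fun w => \sum_(i <- s) f i w) (\sum_(i <- s) a i).
Proof.
move=> fa; elim: s => [|i s IHs].
  under eq_fun do rewrite big_nil; rewrite big_nil.
  split; first exact: integrable0.
  exact: expectation_cst.
under eq_fun do rewrite big_cons; rewrite big_cons.
exact: has_meanD (fa i) IHs.
Qed.

(** Independence says that the joint law is the product of the marginal laws, so
    Fubini factors the integral of the product. *)
Lemma has_meanM (f g : T -> R) (a b : R) : independent P f g ->
  has_mean f a -> has_mean g b -> has_mean (fun w => f w * g w) (a * b).
Proof.
rewrite /has_mean expectation.unlock => fg [fi fa] [gi gb].
have mf : measurable_fun [set: T] f.
  by apply/measurable_EFinP; exact: measurable_int fi.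
have mg : measurable_fun [set: T] g.
  by apply/measurable_EFinP; exact: measurable_int gi.
pose f' : {RV P >-> R} := HB.pack f (isMeasurableFun.Build _ _ _ _ f mf).
pose g' : {RV P >-> R} := HB.pack g (isMeasurableFun.Build _ _ _ _ g mg).
pose lf := distribution P f'; pose lg := distribution P g'.
have mfg : measurable_fun [set: T] (fun w => (f w, g w)).
  exact: measurable_fun_pair.
pose joint := image_measure P mfg.
have jointE C : measurable C -> joint C = (lf \x lg)%E C.
  apply: measure_rectangles_unique => [|A B mA mB].
    by rewrite [ltLHS](_ : _ = P setT)// probability_setT ltry.
  rewrite [RHS]product_measure1E//; exact: fg.
pose mul (z : R * R) := (z.1 * z.2)%:E.
have mmul : measurable_fun [set: R * R] mul.
  by apply/measurable_EFinP/measurable_funM;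
    [exact: measurable_fst|exact: measurable_snd].
have mEFin : measurable_fun [set: R] (@EFin R) by exact/measurable_EFinP.
have lfi : lf.-integrable [set: R] (fun x => x%:E).
  exact: (integrable_pushforward mf mEFin fi measurableT).
have lgi : lg.-integrable [set: R] (fun x => x%:E).
  exact: (integrable_pushforward mg mEFin gi measurableT).
have prodi : (lf \x lg)%E.-integrable [set: R * R] mul.
  apply/integrable12ltyP => //.
  under eq_integral => x _.
    under eq_integral => y _ do rewrite /mul/= normrM EFinM.
    rewrite ge0_integralZl//; last exact/measurable_EFinP.
    over.
  rewrite /= ge0_integralZr//.
  - move/integrableP : lfi => [_ lfoo]; move/integrableP : lgi => [_ lgoo].
    by apply: lte_mul_pinfty => //; rewrite ?ge0_fin_numE// integral_ge0.
  - exact/measurable_EFinP.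
  - by apply: integral_ge0 => y _; rewrite lee_fin.
have fgi : P.-integrable [set: T] (EFin \o (fun w => f w * g w)).
  apply/integrableP; split; first by apply/measurable_EFinP/measurable_funM.
  have /integrableP[_] := prodi; apply: le_lt_trans.
  rewrite [leRHS](eq_measure_integral joint) => [|C mC _]; last first.
    exact/esym/jointE.
  by rewrite ge0_integral_pushforward//; exact: measurableT_comp.
split=> //.
transitivity (\int[joint]_z mul z)%E.
  by rewrite integral_pushforward.
rewrite (eq_measure_integral (lf \x lg)%E) => [|C mC _]; last exact: jointE.
rewrite -integral12_prod_meas1// /fubini_F.
under eq_integral => x _.
  under eq_integral => y _ do rewrite /mul/= EFinM.
  rewrite integralZl// (integral_distribution (X := g'))// gb.
  over.
rewrite /= integralZr// (integral_distribution (X := f'))//.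
by rewrite fa EFinM.
Qed.

End has_mean.

Lemma has_mean_ge0 d (T : measurableType d) (R : realType)
    (P : probability T R) (f : T -> R) :
  measurable_fun [set: T] f -> (forall w, 0 <= f w) ->
  ('E_P[f] < +oo)%E -> exists m, has_mean P f m.
Proof.
move=> mf f0 foo.
have Ef_fin : 'E_P[f]%E \is a fin_num by rewrite ge0_fin_numE// expectation_ge0.
exists (fine 'E_P[f]%E); split; last by rewrite fineK.
apply/integrableP; split; first exact/measurable_EFinP.
move: foo; rewrite expectation.unlock; apply: le_lt_trans.
by under eq_integral do rewrite /= ger0_norm//.
Qed.

Lemma has_mean_integrable d (T : measurableType d) (R : realType)
    (P : probability T R) (f : T -> R) :
  P.-integrable [set: T] (EFin \o f) -> exists m, has_mean P f m.
Proof.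
move=> fi; exists (fine 'E_P[f]%E); split=> //.
by rewrite fineK// expectation.unlock; exact: integrable_fin_num.
Qed.

(** * Standard normal vectors *)

Section standard_normal_vector.
Context d (T : measurableType d) (R : realType) (P : probability T R).
Notation N01 := (normal_prob (0 : R) 1).
Variables (n : nat) (W : T -> 'cV[R]_n).
Hypothesis lawW : has_law P W (power_measure N01 n).

Let measurable_coord (i : 'I_n) : measurable_fun [set: T] 
  (fun w => W w i 0 : measurableTypeR R).
Proof. exact: measurableT_comp (measurable_cV_coord i) lawW.1. Qed.

Lemma std_normal_box (A : 'I_n -> set R) :
  (forall i, measurable (A i)) ->
  (P (W @^-1` box A) = \prod_(i < n) N01 (A i))%E.
Proof.
by move=> mA; rewrite lawW.2 ?power_measure_box//; exact: measurable_box.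
Qed.

Lemma std_normal_coord (i : 'I_n) (A : set R) : measurable A ->
  P ((fun w => W w i 0) @^-1` A) = N01 A.
Proof.
move=> mA; pose B j := if j == i then A else setT.
have -> : (fun w => W w i 0) @^-1` A = W @^-1` box B.
  apply/seteqP; split=> w /=; last by move=> /(_ i); rewrite /B eqxx.
  by move=> Aw j; rewrite /B; case: eqP => [->|].
rewrite std_normal_box => [|j]; last by rewrite /B; case: ifP.
rewrite (bigD1 i)//= /B eqxx big1 ?mule1// => j /negPf ->.
exact: probability_setT.
Qed.

Lemma std_normal_coord_independent (i j : 'I_n) : i != j ->
  independent P (fun w => W w i 0) (fun w => W w j 0).
Proof.
move=> ij A A' mA mA'; rewrite !std_normal_coord//.
pose B k := if k == i then A else if k == j then A' else setT.
have -> : (fun w => W w i 0) @^-1` A `&` (fun w => W w j 0) @^-1` A' =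
    W @^-1` box B.
  apply/seteqP; split=> w /=.
    by move=> [Aw A'w] k; rewrite /B; case: eqP => [->|_]//; case: eqP => [->|].
  move=> Bw; have := Bw i; have := Bw j.
  by rewrite /B eqxx eq_sym (negPf ij) eqxx.
rewrite std_normal_box => [|k]; last by rewrite /B; do 2 case: ifP => //.
rewrite (bigD1 i)//= (bigD1 j) 1?eq_sym//= /B eqxx eq_sym (negPf ij) eqxx.
rewrite big1 ?mule1// => k /andP[/negPf -> /negPf ->].
exact: probability_setT.
Qed.

Lemma ge0_integral_std_normal_coord (i : 'I_n) (f : R -> \bar R) :
  measurable_fun [set: R] f -> (forall x, 0 <= f x)%E ->
  (\int[P]_w f (W w i 0%R) = \int[N01]_x f x)%E.
Proof.
move=> mf f0.
transitivity (\int[image_measure P (measurable_coord i)]_x f x)%E.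
  by rewrite ge0_integral_pushforward.
by apply: eq_measure_integral => A mA _; exact: std_normal_coord.
Qed.

Lemma std_normal_coord_mean (i : 'I_n) : has_mean P (fun w => W w i 0) 0.
Proof.
have int_i : P.-integrable [set: T] (EFin \o (fun w => W w i 0)).
  apply/integrableP; split.
    by apply/measurable_EFinP; exact: measurable_coord.
  rewrite (ge0_integral_std_normal_coord i (f := fun x => `|x%:E|%E))//.
    by case: (integrableP _ _ _ (integrable_std_normal R)).
  by apply: measurableT_comp => //; exact/measurable_EFinP.
split=> //; rewrite expectation.unlock -[RHS]/(0%E) -(std_normal_mean R).
transitivity (\int[image_measure P (measurable_coord i)]_x x%:E)%E.
  by rewrite integral_pushforward//; exact/measurable_EFinP.
apply: eq_measure_integral => A mA _; exact: std_normal_coord.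
Qed.

Lemma std_normal_coord_second_moment (i j : 'I_n) :
  has_mean P (fun w => W w i 0 * W w j 0) (i == j)%:R.
Proof.
have [<-|ij] := eqVneq i j; last first.
  rewrite -[X in has_mean _ _ X](mulr0 0).
  apply: has_meanM; first exact: std_normal_coord_independent.
    exact: std_normal_coord_mean.
  exact: std_normal_coord_mean.
have EW2 : (\int[P]_w (W w i 0%R * W w i 0%R)%:E = 1)%E.
  rewrite -(std_normal_second_moment R).
  rewrite -(ge0_integral_std_normal_coord i (f := fun x => (x ^+ 2)%:E)).
  - by apply: eq_integral => w _; rewrite expr2.
  - by apply/measurable_EFinP; exact: measurable_funX.
  - by move=> x; rewrite lee_fin sqr_ge0.
split; last by rewrite expectation.unlock.
apply/integrableP; split.
  by apply/measurable_EFinP/measurable_funM; exact: measurable_coord.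
under eq_integral do rewrite /= ger0_norm -?expr2 ?sqr_ge0// expr2.
by rewrite EW2 ltry.
Qed.

Lemma std_normal_linear_mean (u : 'rV[R]_n) :
  has_mean P (fun w => (u *m W w) 0 0) 0.
Proof.
under eq_fun do rewrite mxE.
have := has_mean_sum (index_enum 'I_n)
  (fun i => has_meanZ (u 0 i) (std_normal_coord_mean i)).
by rewrite [X in has_mean _ _ X]big1// => i _; rewrite mulr0.
Qed.

(** The (i, j) entry of B is weighted by E W_i W_j, which keeps the diagonal. *)
Lemma std_normal_qform_mean (B : 'M[R]_n) :
  has_mean P (fun w => qform B (W w)) (\tr B).
Proof.
under eq_fun do rewrite qformE.
have -> : \tr B = \sum_(i < n) \sum_(j < n) B i j * (i == j)%:R.
  apply: eq_bigr => i _; rewrite (bigD1 i)//= eqxx mulr1 big1 ?addr0// => j.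
  by rewrite eq_sym => /negPf ->; rewrite mulr0.
apply: has_mean_sum => i; apply: has_mean_sum => j.
exact/has_meanZ/std_normal_coord_second_moment.
Qed.

End standard_normal_vector.

(** [mvnormal_probE] read backwards: applying L^-1 undoes the map z |-> L z that
    carries the standard normal law to the law of X. *)
Lemma cholesky_whitening d (T : measurableType d) (R : realType)
    (P : probability T R) (n : nat) (Sigma : 'M[R]_n) (X : T -> 'cV[R]_n) :
  sym_posdef Sigma -> has_law P X (mvnormal_prob 0 Sigma) ->
  exists L : 'M[R]_n, [/\ L \in unitmx, L *m L^T = Sigma &
    has_law P (fun w => invmx L *m X w)
      (power_measure (normal_prob (0 : R) 1) n)].
Proof.
move=> /cholesky [L [trigL L0 LLT]] [mX lawX]; subst Sigma.
have Lu : L \in unitmx.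
  by rewrite unitmxE unitfE gt_eqF// det_trig// prodr_gt0.
exists L; split=> //; split=> [|A mA].
  exact: measurableT_comp (measurable_mulmx_cV _) mX.
have mLA : measurable [set x | A (invmx L *m x)].
  by rewrite -[X in measurable X]setTI; exact: measurable_mulmx_cV.
rewrite -[LHS]/(P (X @^-1` [set x | A (invmx L *m x)])) lawX//.
rewrite mvnormal_probE//; congr (power_measure _ _ _).
by apply/seteqP; split=> z /=; rewrite mulKmx.
Qed.

(** * Generalized mixtures of normals *)

Section gmn.
Context (R : realType) (disp : measure_display)
    (T : measurableType disp) (P : probability T R)
    (d : nat) (Sigma : 'M[R]_d) (gamma : 'cV[R]_d)
    (H : probability (R * R)%type R) (X : {RV P >-> 'cV[R]_d})
    (U V : {RV P >-> R}) (r s : R -> R -> R)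
    (Rv Sv : {RV P >-> R}) (Y0 : {RV P >-> 'cV[R]_d})
    (Y0_GMN : GMN 0 Sigma gamma H X U V r s Rv Sv Y0).

Lemma GMN_normal_factor_independent : independent P X (fun w => (Rv w, Sv w)).
Proof.
case: Y0_GMN => _ _ XUV mr ms _ RE SE _ _.
have -> : (fun w => (Rv w, Sv w)) =
    (fun uv => (r uv.1 uv.2, s uv.1 uv.2)) \o (fun w => (U w, V w)).
  by apply/funext => w /=; rewrite RE SE.
apply: (independent_comp (p := id)) => //.
  exact: measurable_fun_pair.
exact: mutually_independent3_pair.
Qed.

(** By [qform_decomposition]: the mixed term is the product of R S with an
    independent centred linear form in W, and the trace comes from the form of
    L^T A L in W, since tr (L^T A L) = tr (A L L^T). *)
Lemma GMN_qform_mean (A : 'M[R]_d) (ER2 ES2 : R) :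
  has_mean P (fun w => Rv w ^+ 2) ER2 ->
  has_mean P (fun w => Sv w ^+ 2) ES2 ->
  has_mean P (fun w => qform A (Y0 w))
    (qform A gamma * ER2 + \tr (A *m Sigma) * ES2).
Proof.
move=> meanR2 meanS2.
have [L [Lu LLT lawW]] :=
  cholesky_whitening (GMN_posdef Y0_GMN) (GMN_normal Y0_GMN).
pose W w := invmx L *m X w.
have YE w : Y0 w = Rv w *: gamma + Sv w *: (L *m W w).
  by rewrite (GMN_Y Y0_GMN) add0r mulKVmx.
have indepW dp dq (T' : measurableType dp) (T'' : measurableType dq)
    (p : 'cV[R]_d -> T') (q : R * R -> T'') :
    measurable_fun [set: 'cV[R]_d] p -> measurable_fun [set: R * R] q ->
    independent P (fun w => p (W w)) (fun w => q (Rv w, Sv w)).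
  move=> mp mq.
  apply: (independent_comp (p := fun x => p (invmx L *m x)) (q := q)) => //.
    exact: measurableT_comp mp (measurable_mulmx_cV _).
  exact: GMN_normal_factor_independent.
(* R S is integrable because |R S| <= R^2 + S^2; its mean will be multiplied by
   the mean 0 of a linear form in W. *)
have [ERS meanRS] : exists m, has_mean P (fun w => Rv w * Sv w) m.
  apply: has_mean_integrable.
  apply: le_integrable (has_meanD meanR2 meanS2).1 => //.
    exact/measurable_EFinP/measurable_funM.
  move=> w _ /=; rewrite lee_fin [leRHS]ger0_norm ?addr_ge0 ?sqr_ge0//.
  by rewrite ler_norml; apply/andP; split; nra.
under eq_fun do rewrite YE qform_decomposition.
have -> : qform A gamma * ER2 + \tr (A *m Sigma) * ES2 =
    qform A gamma * ER2 + 0 * ERS + \tr (L^T *m A *m L) * ES2.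
  by rewrite mul0r addr0 [in RHS]mxtrace_mulC mulmxA LLT mxtrace_mulC.
apply: has_meanD; first apply: has_meanD.
- exact: has_meanZ.
- apply: has_meanM => //; last exact: std_normal_linear_mean.
  apply: (indepW _ _ _ _ (fun z => (_ *m z) 0 0) (fun rs => rs.1 * rs.2)).
    exact: measurableT_comp (measurable_cV_coord _) (measurable_mulmx_cV _).
  exact: measurable_funM.
- apply: has_meanM => //; last exact: std_normal_qform_mean.
  apply: (indepW _ _ _ _ (qform _) (fun rs => rs.2 ^+ 2)).
    exact: measurable_qform.
  exact: measurable_funX.
Qed.

(** S^-1 (Y0 - R gamma) is X, whose form in Sigma^-1 is the squared norm of the
    standard normal vector L^-1 X. *)
Lemma GMN_chi_squared :
  has_law P (fun w => Sv w ^- 2 * qform (invmx Sigma) (Y0 w - Rv w *: gamma))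
    (@chi_squared_prob R d).
Proof.
have [L [Lu LLT lawW]] :=
  cholesky_whitening (GMN_posdef Y0_GMN) (GMN_normal Y0_GMN).
pose sumsq (z : 'cV[R]_d) := \sum_(i < d) z i 0 ^+ 2.
have -> : (fun w => Sv w ^- 2 * qform (invmx Sigma) (Y0 w - Rv w *: gamma)) =
    sumsq \o (fun w => invmx L *m X w).
  apply/funext => w /=; have Sw0 : Sv w != 0.
    by rewrite (GMN_S Y0_GMN) gt_eqF// (GMN_s_gt0 Y0_GMN).
  rewrite (GMN_Y Y0_GMN) add0r addrAC subrr add0r.
  rewrite qformZ mulKf ?expf_neq0// -LLT -{1}[X w](mulKVmx Lu).
  exact: qform_invmx_mulmx.
have msumsq : measurable_fun [set: 'cV[R]_d] sumsq.
  apply: measurable_sum => i; apply: measurable_funX.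
  exact: measurable_cV_coord.
split; first exact: measurableT_comp msumsq lawW.1.
move=> A mA.
rewrite -[LHS]/(P ((fun w => invmx L *m X w) @^-1` (sumsq @^-1` A))).
by rewrite lawW.2// -[X in measurable X]setTI; exact: msumsq.
Qed.

End gmn.

Theorem proposition4 (R : realType) (disp : measure_display)
    (T : measurableType disp) (P : probability T R)
    (d : nat) (d_gt0 : (0 < d)%N)
    (Sigma : 'M[R]_d) (gamma : 'cV[R]_d) (H : probability (R * R)%type R)
    (X : {RV P >-> 'cV[R]_d}) (U V : {RV P >-> R}) (r s : R -> R -> R)
    (Rv Sv : {RV P >-> R}) (Y0 : {RV P >-> 'cV[R]_d})
    (Y0_GMN : GMN 0 Sigma gamma H X U V r s Rv Sv Y0)
    (R2_fin : ('E_P[fun w => (Rv w ^+ 2)%R] < +oo)%E)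
    (S2_fin : ('E_P[fun w => (Sv w ^+ 2)%R] < +oo)%E) :
  let Omega := Sigma + gamma *m gamma^T in
  let alpha2 := qform (invmx Sigma) gamma in
  let delta2 := alpha2 / (1 + alpha2) in
  [/\ has_law P
        (fun w => Sv w ^- 2 * qform (invmx Sigma) (Y0 w - Rv w *: gamma))
        (@chi_squared_prob R d),
      ('E_P[fun w => qform (invmx Sigma) (Y0 w)] =
        (d%:R)%R%:E * 'E_P[fun w => (Sv w ^+ 2)%R]
        + alpha2%:E * 'E_P[fun w => (Rv w ^+ 2)%R])%E &
      ('E_P[fun w => qform (invmx Omega) (Y0 w)] =
        (d%:R)%R%:E * 'E_P[fun w => (Sv w ^+ 2)%R]
        + delta2%:E *
          ('E_P[fun w => (Rv w ^+ 2)%R] - 'E_P[fun w => (Sv w ^+ 2)%R]))%E].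
Proof.
move=> Omega alpha2 delta2.
have Sigma_pd := GMN_posdef Y0_GMN.
have [ER2 meanR2] : exists m, has_mean P (fun w => Rv w ^+ 2) m.
  apply: has_mean_ge0 R2_fin; first exact: measurable_funX.
  by move=> w; exact: sqr_ge0.
have [ES2 meanS2] : exists m, has_mean P (fun w => Sv w ^+ 2) m.
  apply: has_mean_ge0 S2_fin; first exact: measurable_funX.
  by move=> w; exact: sqr_ge0.
have Eqform A := (GMN_qform_mean Y0_GMN A meanR2 meanS2).2.
split; first exact: (GMN_chi_squared Y0_GMN).
- rewrite Eqform meanR2.2 meanS2.2 mulVmx ?sym_posdef_unitmx// mxtrace1.
  by rewrite addrC -!EFinM -EFinD.
- have Omega_unit : Omega \in unitmx.
    exact/sym_posdef_unitmx/sym_posdef_rank1.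
  have qO : qform (invmx Omega) gamma = delta2 by exact: qform_invmx_rank1.
  have trO : \tr (invmx Omega *m Sigma) = d%:R - delta2.
    have -> : Sigma = Omega - gamma *m gamma^T by rewrite addrK.
    rewrite mulmxBr mulVmx// linearB/= mxtrace1 mulmxA mxtrace_mulC mulmxA.
    by rewrite trace_mx11 -qO.
  rewrite Eqform meanR2.2 meanS2.2 qO trO -EFinB -!EFinM -EFinD.
  by congr EFin; ring.
Qed.
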